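(* For all odd integers $n\geq 3$ and every $\lambda>-\frac12$, the best Markov constant satisfies $$\frac{(n+1)\big(n+\lambda+\frac12\big)^2(n+2\lambda+1)}{(2\lambda+1)(2\lambda+5)}\leq c_n^2(\lambda)\leq\frac{(n+1)^{3/2}(n+2\lambda+1)^2(n+2\lambda'+1)^{1/2}}{2(2\lambda+1)\sqrt{2\lambda+5}},$$ where $\lambda'=\max\{\lambda,0\}$.
   Context: $\mathcal{P}_n$ denotes the class of real algebraic polynomials of degree at most $n$. For $\lambda>-1/2$, $w_\lambda(t)=(1-t^2)^{\lambda-1/2}$ on $(-1,1)$ and $\Vert f\Vert_{w_\lambda}=\big(\int_{-1}^1 w_\lambda(t)f^2(t)\,dt\big)^{1/2}$. The best Markov constant is $c_n(\lambda)=\sup\{\Vert p'\Vert_{w_\lambda}/\Vert p\Vert_{w_\lambda}: p\in\mathcal{P}_n,\ p\neq 0\}$. *)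

(* Defs.v *)
From HB Require Import structures.
From mathcomp Require Import all_boot all_order all_algebra.
From mathcomp Require Import all_classical all_reals all_analysis.
Set Implicit Arguments. Unset Strict Implicit. Unset Printing Implicit Defensive.
Import Order.TTheory GRing.Theory Num.Theory.
Import numFieldNormedType.Exports.
Local Open Scope classical_set_scope.
Local Open Scope ring_scope.

Definition gweight {R : realType} (lam : R) (t : R) : R :=
  (1 - t ^+ 2) `^ (lam - 2^-1).

(* ||f||_{w_lambda}^2 = int_{-1}^{1} w_lambda(t) f(t)^2 dt  (Lebesgue integral;
   finite for lam > -1/2 and polynomial f, so [fine] is harmless). *)
Definition wnorm2 {R : realType} (lam : R) (f : R -> R) : R :=
  fine (\int[lebesgue_measure]_(t in `](-1)%R, 1%R[) (gweight lam t * f t ^+ 2)%:E)%E.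

Definition wnorm {R : realType} (lam : R) (f : R -> R) : R :=
  Num.sqrt (wnorm2 lam f).

Definition markov_const {R : realType} (n : nat) (lam : R) : \bar R :=
  ereal_sup [set ((wnorm lam (fun t => (p^`()).[t])) / (wnorm lam (fun t => p.[t])))%:E
            | p in [set p : {poly R} | (size p <= n.+1)%N /\ p != 0]].

(* Main.v *)
Require Import Defs.
From HB Require Import structures.
From mathcomp Require Import all_boot all_order all_algebra.
From mathcomp Require Import all_classical all_reals all_analysis.
From mathcomp Require Import measurable_realfun ring lra.
Set Implicit Arguments. Unset Strict Implicit. Unset Printing Implicit Defensive.
Import Order.TTheory GRing.Theory Num.Theory.
Import numFieldNormedType.Exports.
Local Open Scope classical_set_scope.
Local Open Scope ring_scope.

(* Put a = 2 lam + 1.  In a basis of Gegenbauer polynomials differentiation is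
   an upper triangular matrix whose entries factor as (row) * (column) and
   which couples only degrees of opposite parity.  For odd n = 2 M - 1 it thus
   splits into two M x M blocks A, and c_n^2 is the largest eigenvalue of A^T A
   over the two blocks.  It is at most the Frobenius norm tr((A^T A)^2)^(1/2) of
   the larger block, and at least the ratio tr((A^T A)^2) / tr(A^T A) for the
   block acting on odd polynomials.  Because of the factored entries both traces
   telescope to polynomials in N = (n + 1)(n + 1 + 2 lam), and what remains is a
   pair of polynomial inequalities in n and a.  The only analytic input on the
   weight is its total mass being finite and positive, and the identity
   int w ((1 - t^2) q' - a t q) = 0, which determines all the inner products. *)

(** * Gegenbauer polynomials *)

Section Gegenbauer.
Variables (R : realType) (lam : R).
Hypothesis lam_gt : - 2^-1 < lam.

(* gegU k is the classical C_{k-1}^{(lam+1)}, with gegU 0 = 0, and gegW k is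
   ((k + lam) / lam) C_k^{(lam)}; this scaling stays meaningful at lam = 0. *)
Fixpoint gegU_pair (k : nat) : {poly R} * {poly R} :=
  if k is j.+1 then
    let: (u, v) := gegU_pair j in
    (v, (j.+1%:R^-1)%:P * (2 * (j.+1%:R + lam%:P) * 'X * v
                             - (j.+1%:R + 2 * lam%:P) * u))
  else (0, 1).

Definition gegU k := (gegU_pair k).1.

Definition gegW k := if k is j.+1 then gegU j.+2 - gegU j else 1.

Lemma gegU0 : gegU 0 = 0. Proof. by []. Qed.
Lemma gegU1 : gegU 1 = 1. Proof. by []. Qed.

Lemma deriv_nat (k : nat) : (k%:R : {poly R})^`() = 0.
Proof. by rewrite -polyC_natr derivC. Qed.

Lemma gegU_rec k :
  k.+1%:R * gegU k.+2 = 2 * (k.+1%:R + lam%:P) * 'X * gegU k.+1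
                        - (k.+1%:R + 2 * lam%:P) * gegU k.
Proof.
have E j : gegU_pair j = (gegU j, gegU j.+1).
  by rewrite /gegU /=; case: (gegU_pair j).
rewrite {1}/gegU /= E /= mulrA -polyC_natr -polyCM divff ?pnatr_eq0 // mul1r.
by rewrite polyC_natr.
Qed.

Lemma natr_poly_mulI k : injective (fun p : {poly R} => k.+1%:R * p).
Proof. by apply: mulfI; rewrite -polyC_natr polyC_eq0 pnatr_eq0. Qed.

(** Differentiate the recurrence and eliminate the derivative of [gegU k]. The premise is the first
    half of [gegU_deriv_both], whose induction calls this lemma. *)
Lemma gegU_deriv_step k :
    'X * (gegU k.+1)^`() - (gegU k)^`() = k%:R * gegU k.+1 ->
  (gegU k.+2)^`() = (gegU k)^`() + 2 * (k.+1%:R + lam%:P) * gegU k.+1.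
Proof.
move=> B; apply: (@natr_poly_mulI k).
have := congr1 (@deriv R) (gegU_rec k).
rewrite derivB !derivM !derivD !derivM !deriv_nat !derivC derivX.
rewrite !(mul0r, add0r, addr0, mulr0, mulr1) => ->.
have -> : (gegU k)^`() = 'X * (gegU k.+1)^`() - k%:R * gegU k.+1.
  by rewrite -B; ring.
by rewrite -natr1; ring.
Qed.

(** The two identities need each other: through [gegU_deriv_step], the second at [k] gives the first
    at [k.+1], and the first at [k] gives the second at [k.+1]. *)
Lemma gegU_deriv_both k :
  'X * (gegU k.+1)^`() - (gegU k)^`() = k%:R * gegU k.+1 /\
  (gegU k.+1)^`() = 'X * (gegU k)^`() + (k.+1%:R + 2 * lam%:P) * gegU k.
Proof.
elim: k => [|k [B C]].
  by rewrite gegU0 gegU1 -polyC1 !derivC; split; ring.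
have A := gegU_deriv_step B; split; rewrite A.
  rewrite C; have := gegU_rec k; rewrite -![k.+1%:R]natr1 => E.
  transitivity ((k%:R + 1) * gegU k.+2 +
     (2 * (k%:R + 1 + lam%:P) * 'X * gegU k.+1
        - (k%:R + 1 + 2 * lam%:P) * gegU k - (k%:R + 1) * gegU k.+2)); first ring.
  by rewrite E; ring.
have -> : (gegU k)^`() = 'X * (gegU k.+1)^`() - k%:R * gegU k.+1.
  by rewrite -B; ring.
by rewrite -![k.+2%:R]natr1 -![k.+1%:R]natr1; ring.
Qed.

(** The source of the factored entries: each derivative is a single [gegU], and the factor [k + lam]
    depends on the column alone. *)
Lemma gegW_deriv k : (gegW k)^`() = 2 * (k%:R + lam%:P) * gegU k.
Proof.
case: k => [|k]; first by rewrite /= -polyC1 derivC gegU0 mulr0.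
by rewrite /= derivB (gegU_deriv_step (gegU_deriv_both k).1); ring.
Qed.

Lemma gegW_ode k :
  (1 - 'X ^+ 2) * (gegW k)^`()^`() - (2 * lam%:P + 1) * 'X * (gegW k)^`()
  + k%:R * (k%:R + 2 * lam%:P) * gegW k = 0.
Proof.
case: k => [|k]; first by rewrite /= -polyC1 !derivC; ring.
rewrite gegW_deriv derivM.
have -> : (2 * (k.+1%:R + lam%:P) : {poly R})^`() = 0.
  by rewrite -!polyC_natr -polyCD -polyCM derivC.
have [B C] := gegU_deriv_both k.+1.
(* Eliminating the derivative of [gegU k.+2] between [B] and [C] leaves only the three-term
   recurrence to check. *)
have D : (1 - 'X ^+ 2) * (gegU k.+1)^`() =
    (k.+2%:R + 2 * lam%:P) * 'X * gegU k.+1 - k.+1%:R * gegU k.+2.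
  by rewrite -B C; ring.
rewrite mul0r add0r.
transitivity (2 * (k.+1%:R + lam%:P) * ((1 - 'X ^+ 2) * (gegU k.+1)^`())
   - (2 * lam%:P + 1) * 'X * (2 * (k.+1%:R + lam%:P) * gegU k.+1)
   + (k.+1%:R + 2 * lam%:P) * (k.+1%:R * gegU k.+2 - k.+1%:R * gegU k)).
  by rewrite /=; ring.
rewrite D -[k.+2%:R]natr1.
transitivity (k.+1%:R * (2 * (k.+1%:R + lam%:P) * 'X * gegU k.+1
                        - (k.+1%:R + 2 * lam%:P) * gegU k - k.+1%:R * gegU k.+2)).
  by rewrite /=; ring.
by rewrite gegU_rec subrr mulr0.
Qed.

Lemma size_gegU k : (size (gegU k) <= k)%N.
Proof.
suff: (size (gegU k) <= k)%N /\ (size (gegU k.+1) <= k.+1)%N by case.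
elim: k => [|k [Uk Uk1]]; first by rewrite gegU0 gegU1 size_poly0 size_poly1.
split=> //.
have -> : gegU k.+2 = (k.+1%:R^-1 * (2 * (k.+1%:R + lam))) *: ('X * gegU k.+1)
                      - (k.+1%:R^-1 * (k.+1%:R + 2 * lam)) *: gegU k.
  have V : k.+1%:R * (k.+1%:R^-1)%:P = 1 :> {poly R}.
    by rewrite -(polyC_natr _ k.+1) -polyCM divff ?pnatr_eq0.
  apply: (@natr_poly_mulI k); rewrite gegU_rec -!mul_polyC !polyCM.
  transitivity (k.+1%:R * (k.+1%:R^-1)%:P * (2%:P * (k.+1%:R + lam)%:P * 'X * gegU k.+1
                  - (k.+1%:R + 2 * lam)%:P * gegU k)); last ring.
  by rewrite V mul1r !(polyCD, polyCM, polyC_natr); ring.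
rewrite (leq_trans (size_polyD _ _)) // geq_max size_polyN.
rewrite !(leq_trans (size_scale_leq _ _)) //; first by rewrite (leq_trans Uk) // ltnW.
by rewrite (leq_trans (size_polyMleq _ _)) // size_polyX add2n /= ltnS.
Qed.

Lemma size_gegW k : (size (gegW k) <= k.+1)%N.
Proof.
case: k => [|k]; first by rewrite /= size_poly1.
rewrite (leq_trans (size_polyD _ _)) // geq_max size_polyN size_gegU /=.
by rewrite (leq_trans (size_gegU _)) // ltnW.
Qed.

(** * Expansion of polynomials in the [gegW] *)

Definition gegW_spanned n (p : {poly R}) :=
  exists c : nat -> R, p = \sum_(k < n) (c k)%:P * gegW k.

Lemma gegW_spannedD n p q :
  gegW_spanned n p -> gegW_spanned n q -> gegW_spanned n (p + q).
Proof.
move=> [c ->] [d ->]; exists (fun k => c k + d k).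
by rewrite -big_split; apply: eq_bigr => k _; rewrite polyCD mulrDl.
Qed.

Lemma gegW_spannedZ n p a : gegW_spanned n p -> gegW_spanned n (a%:P * p).
Proof.
move=> [c ->]; exists (fun k => a * c k).
by rewrite mulr_sumr; apply: eq_bigr => k _; rewrite polyCM mulrA.
Qed.

Lemma gegW_spannedS n p : gegW_spanned n p -> gegW_spanned n.+1 p.
Proof.
move=> [c ->]; exists (fun k => if (k < n)%N then c k else 0).
rewrite big_ord_recr /= ltnn mul0r addr0.
by apply: eq_bigr => k _; rewrite ltn_ord.
Qed.

Lemma gegW_spannedW k : gegW_spanned k.+1 (gegW k).
Proof.
exists (fun j => (j == k)%:R).
rewrite big_ord_recr /= eqxx mul1r big1 ?add0r // => j _.
by rewrite (ltn_eqF (ltn_ord j)) mul0r.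
Qed.

Lemma gegW_spanned0 n : gegW_spanned n 0.
Proof. by exists (fun=> 0); rewrite big1 // => k _; rewrite mul0r. Qed.

Lemma gegU_W k : gegU k.+2 = gegU k + gegW k.+1.
Proof. by rewrite /=; ring. Qed.

Lemma gegU_spanned k : gegW_spanned k (gegU k) /\ gegW_spanned k.+1 (gegU k.+1).
Proof.
elim: k => [|k [Uk Uk1]].
  by split; [exact: gegW_spanned0 | exact: (gegW_spannedW 0)].
split=> //; rewrite gegU_W; apply: gegW_spannedD; last exact: gegW_spannedW.
exact/gegW_spannedS/gegW_spannedS.
Qed.

(** The recurrence is solved for its ['X] term; the division is legitimate because [k.+1 + lam] is
    positive. *)
Lemma gegXU_spanned k : gegW_spanned k.+1 ('X * gegU k).
Proof.
case: k => [|k]; first by rewrite mulr0; exact: gegW_spanned0.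
have k1lam : 2 * (k.+1%:R + lam) != 0.
  apply: lt0r_neq0; have k0 := ler0n R k; have l0 := lam_gt.
  by rewrite -[k.+1%:R]natr1; lra.
have -> : 'X * gegU k.+1 = ((2 * (k.+1%:R + lam))^-1)%:P *
    ((k.+1%:R)%:P * gegU k.+2 + (k.+1%:R + 2 * lam)%:P * gegU k).
  have -> : (k.+1%:R)%:P * gegU k.+2 + (k.+1%:R + 2 * lam)%:P * gegU k =
      (2 * (k.+1%:R + lam))%:P * ('X * gegU k.+1).
    by rewrite !polyC_natr gegU_rec !(polyCD, polyCM, polyC_natr); ring.
  by rewrite [RHS]mulrA -polyCM mulVf // mul1r.
apply/gegW_spannedZ/gegW_spannedD; apply: gegW_spannedZ.
  exact: (gegU_spanned _).1.
by do 2!apply: gegW_spannedS; exact: (gegU_spanned _).1.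
Qed.

Lemma gegXW_spanned k : gegW_spanned k.+2 ('X * gegW k).
Proof.
case: k => [|k]; first exact: (gegXU_spanned 1).
have -> : 'X * gegW k.+1 = 'X * gegU k.+2 + (-1)%:P * ('X * gegU k).
  by rewrite /= polyCN; ring.
apply: gegW_spannedD; first exact: gegXU_spanned.
by apply: gegW_spannedZ; do 2!apply: gegW_spannedS; exact: gegXU_spanned.
Qed.

Lemma gegW_spannedX n p : gegW_spanned n p -> gegW_spanned n.+1 ('X * p).
Proof.
move=> [c ->]; elim: n => [|n IHn].
  by rewrite big_ord0 mulr0; exact: gegW_spanned0.
rewrite big_ord_recr mulrDr; apply: gegW_spannedD; first exact: gegW_spannedS.
by rewrite mulrCA; apply/gegW_spannedZ/gegXW_spanned.
Qed.

(** Multiplication by ['X] enlarges the span by one index only, so induction along [p * 'X + c]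
    suffices and no leading coefficient has to be computed. *)
Lemma gegW_expansion n (p : {poly R}) :
  (size p <= n)%N -> exists c : nat -> R, p = \sum_(k < n) (c k)%:P * gegW k.
Proof.
elim/poly_ind: p n => [|p c IHp] n szp; first exact: gegW_spanned0.
have [->|nz] := eqVneq (p * 'X + c%:P) 0; first exact: gegW_spanned0.
case: n szp => [|n szp].
  by rewrite leqn0 size_poly_eq0 (negbTE nz).
apply: gegW_spannedD.
  rewrite mulrC; apply/gegW_spannedX/IHp.
  by move: szp; rewrite size_MXaddC; case: ifP => // /andP[/eqP-> _]; rewrite size_poly0.
rewrite -[c%:P]mulr1; apply: gegW_spannedZ.
exists (fun k => (k == 0)%:R); rewrite big_ord_recl big1 ?addr0 ?mul1r // => i _.
by rewrite mul0r.
Qed.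
End Gegenbauer.

(** * Quadratic forms with a kernel depending on the minimum *)

Section MinKernel.
Variable R : realFieldType.

Lemma le_eq2 (a b a' b' : R) : a = a' -> b = b' -> a <= b -> a' <= b'.
Proof. by move=> -> ->. Qed.

(** Expanding a weighted sum of squares gives B (B A - C^2) >= 0, which settles B > 0. If B = 0,
    every w b^2 vanishes and with it every term of C. *)
Lemma weighted_cauchy_schwarz (I : finType) (w a b : I -> R) :
    (forall i, 0 <= w i) ->
  (\sum_i w i * (a i * b i)) ^+ 2 <=
  (\sum_i w i * a i ^+ 2) * (\sum_i w i * b i ^+ 2).
Proof.
move=> w0; set A := \sum_i _ * a _ ^+ 2; set B := \sum_i _ * b _ ^+ 2.
set C := \sum_i _.
have B0 : 0 <= B by apply: sumr_ge0 => i _; rewrite mulr_ge0 ?sqr_ge0.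
have : 0 <= \sum_i w i * (B * a i - C * b i) ^+ 2.
  by apply: sumr_ge0 => i _; rewrite mulr_ge0 ?sqr_ge0.
have -> : \sum_i w i * (B * a i - C * b i) ^+ 2 = B * (B * A - C ^+ 2).
  transitivity (B ^+ 2 * A - 2 * B * C * C + C ^+ 2 * B); last by ring.
  have -> : B ^+ 2 * A = \sum_i B ^+ 2 * (w i * a i ^+ 2) by rewrite mulr_sumr.
  have -> : 2 * B * C * C = \sum_i 2 * B * C * (w i * (a i * b i)).
    by rewrite -mulr_sumr.
  have -> : C ^+ 2 * B = \sum_i C ^+ 2 * (w i * b i ^+ 2) by rewrite mulr_sumr.
  by rewrite -sumrB -big_split; apply: eq_bigr => i _; rewrite /=; ring.
have [B_gt0|] := ltP 0 B; first by rewrite pmulr_rge0 // subr_ge0 mulrC.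
move=> B_le0 _; have B_eq0 : B = 0 by apply/le_anti/andP.
have wb i : w i * b i ^+ 2 = 0.
  apply/eqP; have := B_eq0 => /eqP; rewrite psumr_eq0 => [/allP/(_ i)|j _].
    by move=> /(_ (mem_index_enum _)).
  by rewrite mulr_ge0 ?sqr_ge0.
rewrite B_eq0 mulr0 /C big1 ?expr0n // => i _; apply/eqP.
by have /eqP := wb i; rewrite !mulf_eq0 orbb; case/orP => ->; rewrite ?orbT.
Qed.

(** The Frobenius bound for a form measured against the diagonal form [H]: Cauchy-Schwarz over the
    pairs (i, j) with weights [H i * H j]. *)
Lemma min_kernel_upper N (x H s c : nat -> R) : (forall i, 0 < H i) ->
  (\sum_(i < N) \sum_(j < N) c i * c j * (4 * x i * x j * s (minn i j))) ^+ 2 <=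
  (\sum_(i < N) \sum_(j < N)
     (4 * x i ^+ 2 / H i) * (4 * x j ^+ 2 / H j) * s (minn i j) ^+ 2) *
  (\sum_(i < N) c i ^+ 2 * H i) ^+ 2.
Proof.
move=> H0; have H1 i : H i != 0 by rewrite gt_eqF.
have := @weighted_cauchy_schwarz ('I_N * 'I_N)%type
  (fun p => H p.1 * H p.2)
  (fun p => 4 * x p.1 * x p.2 * s (minn p.1 p.2) / (H p.1 * H p.2))
  (fun p => c p.1 * c p.2) (fun p => ltW (mulr_gt0 (H0 p.1) (H0 p.2))).
have -> : (\sum_(i < N) c i ^+ 2 * H i) ^+ 2 =
    \sum_(i < N) \sum_(j < N) (c i ^+ 2 * H i) * (c j ^+ 2 * H j).
  by rewrite expr2 big_distrlr.
rewrite /= !pair_bigA /= => h; apply: (le_eq2 _ _ h); [congr (_ ^+ 2)|congr (_ * _)];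
  apply: eq_bigr => -[i j] _ /=; last by ring.
  by field; rewrite !H1.
by field; rewrite !H1.
Qed.

(** The new row and column see only the old index in the minimum; this drives the induction in
    [geg_frobenius]. *)
Lemma min_kernel_recr N (r s : nat -> R) :
  \sum_(i < N.+1) \sum_(j < N.+1) r i * r j * s (minn i j) ^+ 2 =
  \sum_(i < N) \sum_(j < N) r i * r j * s (minn i j) ^+ 2 +
  r N * (r N * s N ^+ 2 + 2 * \sum_(i < N) r i * s i ^+ 2).
Proof.
rewrite big_ord_recr; under eq_bigr do rewrite big_ord_recr.
rewrite big_split big_ord_recr /= minnn -addrA; congr (_ + _).
have E (i : 'I_N) : minn i N = i by apply/minn_idPl/ltnW.
under eq_bigr do rewrite E; under [X in _ + (X + _)]eq_bigr do rewrite minnC E.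
have -> : \sum_(i < N) r i * r N * s i ^+ 2 = r N * \sum_(i < N) r i * s i ^+ 2.
  by rewrite mulr_sumr; apply: eq_bigr => i _; ring.
have -> : \sum_(i < N) r N * r i * s i ^+ 2 = r N * \sum_(i < N) r i * s i ^+ 2.
  by rewrite mulr_sumr; apply: eq_bigr => i _; ring.
by ring.
Qed.

(* With v_j the j-th row of A, sum_j |A v_j|^2 = tr((A^T A)^2) and
   sum_j |v_j|^2 = tr(A^T A); d j below is the squared row factor. *)
Lemma min_kernel_lower N (x H s : nat -> R) (C : R) :
    (forall i, 0 < H i) -> 0 <= s 0 -> (forall i, s i <= s i.+1) ->
    (forall c : nat -> R,
       \sum_(i < N) \sum_(j < N) c i * c j * (4 * x i * x j * s (minn i j)) <=
       C * \sum_(i < N) c i ^+ 2 * H i) ->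
  \sum_(i < N) \sum_(j < N)
     (4 * x i ^+ 2 / H i) * (4 * x j ^+ 2 / H j) * s (minn i j) ^+ 2 <=
  C * \sum_(i < N) 4 * x i ^+ 2 / H i * s i.
Proof.
move=> H0 s0 s_mono HC; have H1 i : H i != 0 by rewrite gt_eqF.
(* Increments of [s], so that [s (minn i k)] is the sum of [d j] over j <= min(i, k). *)
pose d j := if j is k.+1 then s k.+1 - s k else s 0.
have d0 j : 0 <= d j by case: j => [|j] //=; rewrite subr_ge0.
have sd i : (i < N)%N -> s i = \sum_(j < N) (j <= i)%N%:R * d j.
  elim: i => [|i IHi] iN.
    case: N iN {HC} => // N _; rewrite big_ord_recl /= mul1r big1 ?addr0 // => k _.
    by rewrite mul0r.
  have -> : s i.+1 = s i + d i.+1 by rewrite /=; ring.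
  rewrite IHi 1?ltnW // (bigD1 (Ordinal iN)) //= [RHS](bigD1 (Ordinal iN)) //=.
  rewrite ltnn leqnn mul0r add0r mul1r addrC; congr (_ + _).
  apply: eq_bigr => j ji; rewrite [in RHS]leq_eqVlt ltnS.
  by case: eqP => //= ji'; case/eqP: ji; apply: val_inj.
(* Up to sqrt(d j) and the normalisation by [H], this is the row v_j. Weighting the j-th inequality
   by [d j] avoids the square root. *)
pose c j i : R := (j <= i)%N%:R * (2 * x i / H i).
have : \sum_(j < N) d j * (\sum_(i < N) \sum_(k < N)
          c j i * c j k * (4 * x i * x k * s (minn i k))) <=
       \sum_(j < N) d j * (C * \sum_(i < N) c j i ^+ 2 * H i).
  by apply: ler_sum => j _; apply: ler_wpM2l => //; exact: HC.
apply: le_eq2.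
- under eq_bigr do rewrite mulr_sumr.
  rewrite exchange_big; apply: eq_bigr => i _.
  under eq_bigr do rewrite mulr_sumr.
  rewrite exchange_big; apply: eq_bigr => k _.
  (* One factor [s (minn i k)] is the kernel's own; the other is the total weight [d j] of the rows
     that meet both columns. *)
  transitivity (4 * x i ^+ 2 / H i * (4 * x k ^+ 2 / H k) * s (minn i k) *
      \sum_(j < N) (j <= minn i k)%N%:R * d j); last first.
    by rewrite -sd ?gtn_min ?ltn_ord // -!mulrA.
  rewrite mulr_sumr; apply: eq_bigr => j _.
  rewrite /c leq_min -mulnb natrM; field.
  by rewrite !H1.
- transitivity (C * \sum_(j < N) \sum_(i < N) d j * (c j i ^+ 2 * H i)).
    by rewrite mulr_sumr; apply: eq_bigr => j _; rewrite mulrCA mulr_sumr.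
  congr (_ * _); rewrite exchange_big; apply: eq_bigr => i _.
  rewrite sd // mulr_sumr; apply: eq_bigr => j _.
  rewrite /c !exprMn; have -> : (j <= i)%N%:R ^+ 2 = (j <= i)%N%:R :> R.
    by case: leqP; rewrite ?expr0n ?expr1n.
  by field.
Qed.
End MinKernel.

(** * Closed forms of the traces *)

Section TraceFormulas.
Variable R : realFieldType.
Implicit Types (a x m : R).

(* geg_t a k is the k-th diagonal entry of A^T A; geg_inc a k is the growth of
   tr((A^T A)^2) when the degree k is added to its parity class. *)
Definition geg_t a x := (2 * x + a - 1) * x * (x + a - 1) / a.

(** By [sum_geg_rs2], [geg_s k * geg_z a k] is the off-diagonal sum over the smaller degrees of the
    parity of k. *)
Definition geg_z a x :=
  (x - 1) * (x - 2) / a * ((x - 3) * (x + a) / (a + 4) + a / (a + 2)).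

Definition geg_inc a x := geg_t a x * (geg_t a x + 2 * geg_z a x).

(** Up to the factor N and a denominator in a, this is tr((A^T A)^2) for the odd block; see
    [sum_geg_inc]. *)
Definition geg_cubic a N :=
  (a + 2) * N ^+ 3 + 2 / 3 * (a ^+ 3 + 5 * a ^+ 2 + 4 * a - 12) * N ^+ 2
  + (8 - 88 / 3 * a - 74 / 3 * a ^+ 2 - 16 / 3 * a ^+ 3) * N
  + (40 * a + 148 / 3 * a ^+ 2 + 8 * a ^+ 3 - 2 * a ^+ 4 - 2 / 3 * a ^+ 5).

Lemma sum_geg_t a M : 0 < a ->
  \sum_(i < M) geg_t a (i.*2 + 1)%:R =
  let N := M.*2%:R * (M.*2%:R + a - 1) in N * (N - 2) / (4 * a).
Proof.
move=> a0 /=; elim: M => [|M IHM]; first by rewrite big_ord0 !mul0r.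
rewrite big_ord_recr /= IHM /geg_t natrD doubleS -addn2 natrD.
by field; rewrite gt_eqF.
Qed.

Lemma sum_geg_inc a M : 0 < a ->
  \sum_(i < M) geg_inc a (i.*2 + 1)%:R =
  let N := M.*2%:R * (M.*2%:R + a - 1) in
  N * geg_cubic a N / (4 * a ^+ 2 * (a + 2) * (a + 4)).
Proof.
move=> a0 /=; elim: M => [|M IHM]; first by rewrite big_ord0 !mul0r.
rewrite big_ord_recr /= IHM /geg_inc /geg_t /geg_z /geg_cubic natrD doubleS -addn2 natrD.
have h2 : a + 2 != 0 by apply: lt0r_neq0; lra.
have h4 : a + 4 != 0 by apply: lt0r_neq0; lra.
have h1 : a != 0 by apply: lt0r_neq0; lra.
by field; rewrite h1 h2 h4.
Qed.

(** * Inequalities for the traces *)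

Lemma geg_t_ge0 a x : 0 < a -> 1 <= x -> 0 <= geg_t a x.
Proof.
by move=> a0 x1; rewrite divr_ge0 ?mulr_ge0 ?(ltW a0) //; lra.
Qed.

Lemma geg_t_le a x : 0 < a -> 1 <= x -> geg_t a x <= geg_t a (x + 1).
Proof.
move=> a0 x1; rewrite ler_pM2r ?invr_gt0 //.
by rewrite !ler_pM ?mulr_ge0 //; lra.
Qed.

Lemma geg_z_ge0 a x : 0 < a -> 3 <= x -> 0 <= geg_z a x.
Proof.
move=> a0 x3; rewrite mulr_ge0 ?addr_ge0 ?divr_ge0 ?mulr_ge0 //; lra.
Qed.

Lemma geg_z_le a x : 0 < a -> 3 <= x -> geg_z a x <= geg_z a (x + 1).
Proof.
move=> a0 x3; rewrite ler_pM ?addr_ge0 ?divr_ge0 ?mulr_ge0 //; try lra.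
  by rewrite ler_pM2r ?invr_gt0 // ler_pM //; lra.
by rewrite lerD2r ler_pM2r ?invr_gt0 ?ler_pM //; lra.
Qed.

(** Makes the odd block the larger one, degree by degree. Degrees 0 and 2 are separate, since
    [geg_z] is shown nonnegative and monotone only from 3 on. *)
Lemma geg_inc_even_le_odd a i : 0 < a ->
  geg_inc a (i.*2 + 0)%:R <= geg_inc a (i.*2 + 1)%:R.
Proof.
move=> a0; rewrite addn0; case: i => [|i].
  have -> : geg_inc a 0%:R = 0 by rewrite /geg_inc /geg_t !(mulr0, mul0r).
  have -> : geg_inc a (0.*2 + 1)%:R = geg_t a 1 ^+ 2.
    by rewrite double0 add0n /geg_inc /geg_z subrr !mul0r mulr0 addr0 expr2.
  exact: sqr_ge0.
rewrite natrD; set x := (i.+1.*2)%:R.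
have x2 : 2 <= x by rewrite /x ler_nat.
have t0 : 0 <= geg_t a x by apply: geg_t_ge0 => //; lra.
have z0 : 0 <= geg_z a x <= geg_z a (x + 1).
  case: i @x x2 {t0} => [|i] x x2.
    have -> : geg_z a x = 0 by rewrite /geg_z subrr !(mulr0, mul0r).
    by rewrite lexx geg_z_ge0 //; rewrite /x; lra.
  have x3 : 3 <= x by rewrite /x ler_nat.
  by rewrite geg_z_ge0 // geg_z_le.
case/andP: z0 => z0 z1.
have t1 : geg_t a x <= geg_t a (x + 1) by rewrite geg_t_le //; lra.
by rewrite /geg_inc ler_pM //; lra.
Qed.

(** At m = 4, N equals 12 + 4 a. The difference of the two sides is expanded in m - 4 and N - (12 +
    4 a) with nonnegative coefficients; the remainder is its value at m = 4. *)
Lemma geg_cubic_lower a m : 0 < a -> 4 <= m ->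
  let N := m * (m + a - 1) in
  (a + 2) * N * (N - 2) * (m + a / 2 - 1) ^+ 2 <= geg_cubic a N.
Proof.
move=> a0 m4; set N := m * (m + a - 1) => /=.
have N0 : 12 + 4 * a <= N.
  have -> : 12 + 4 * a = 4 * (3 + a) :> R by ring.
  by rewrite ler_pM //; lra.
have [a2 a3 a4 a5] : [/\ 0 <= a ^+ 2, 0 <= a ^+ 3, 0 <= a ^+ 4 & 0 <= a ^+ 5].
  by split; apply/exprn_ge0/ltW.
pose E := 5 / 12 * a ^+ 3 + 23 / 6 * a ^+ 2 + 17 / 3 * a - 6 + (a + 2) * m.
pose K := 20 + 254 / 3 * a + 59 * a ^+ 2 + 31 / 2 * a ^+ 3 + 5 / 3 * a ^+ 4.
(* As m >= 4, the term (a + 2) m outweighs the constant -6. *)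
have E0 : 0 <= E.
  have : 0 <= (a + 2) * (m - 4) by rewrite mulr_ge0 //; lra.
  by rewrite /E; lra.
have K0 : 0 <= K by rewrite /K; lra.
have -> : geg_cubic a N = (a + 2) * N * (N - 2) * (m + a / 2 - 1) ^+ 2
    + E * N * (N - (12 + 4 * a)) + (10 + 4 * a) * (a + 2) * (m - 4) * N
    + K * (N - (12 + 4 * a))
    + (240 + 1136 * a + 1096 * a ^+ 2 + 430 * a ^+ 3 + 80 * a ^+ 4 + 6 * a ^+ 5).
  by rewrite /geg_cubic /E /K /N; field.
have h1 : 0 <= E * N * (N - (12 + 4 * a)) by rewrite !mulr_ge0 //; lra.
have h2 : 0 <= (10 + 4 * a) * (a + 2) * (m - 4) * N by rewrite !mulr_ge0 //; lra.
have h3 : 0 <= K * (N - (12 + 4 * a)) by rewrite mulr_ge0 //; lra.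
lra.
Qed.

(** For a <= 1 the coefficient of N^2 is negative, so N >= 12 trades N^2 for 12 N; the resulting
    linear term is at most -10 N, which absorbs the constant term. *)
Lemma geg_cubic_upper_le1 a m : 0 < a -> a <= 1 -> 4 <= m ->
  let N := m * (m + a - 1) in geg_cubic a N <= (a + 2) * N ^+ 3.
Proof.
move=> a0 a1 m4 /=; set N := m * _.
have N12 : 12 <= N.
  have -> : 12 = 4 * 3 :> R by ring.
  by rewrite ler_pM //; lra.
have a2 : 0 <= a ^+ 2 <= 1 by rewrite sqr_ge0 expr_le1 // ltW.
have a3 : 0 <= a ^+ 3 <= 1 by rewrite exprn_ge0 ?expr_le1 // ltW.
have a4 : 0 <= a ^+ 4 by rewrite exprn_ge0 // ltW.
have a5 : 0 <= a ^+ 5 by rewrite exprn_ge0 // ltW.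
rewrite /geg_cubic.
have H1 : 2 / 3 * (a ^+ 3 + 5 * a ^+ 2 + 4 * a - 12) * N ^+ 2 <=
    8 * (a ^+ 3 + 5 * a ^+ 2 + 4 * a - 12) * N.
  rewrite [N ^+ 2]expr2 [leLHS]mulrA ler_wpM2r //; first by lra.
  have : 0 <= (12 - (a ^+ 3 + 5 * a ^+ 2 + 4 * a)) * (N - 12).
    by rewrite mulr_ge0 //; lra.
  lra.
have H2 : (8 * (a ^+ 3 + 5 * a ^+ 2 + 4 * a - 12) +
   (8 - 88 / 3 * a - 74 / 3 * a ^+ 2 - 16 / 3 * a ^+ 3)) * N <= - 10 * N.
  by rewrite ler_wpM2r //; lra.
lra.
Qed.

(** For a >= 1 the difference of the two sides is expanded in m - 4 and N - 16, now using N >=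
    16. *)
Lemma geg_cubic_upper_ge1 a m : 1 <= a -> 4 <= m ->
  let N := m * (m + a - 1) in
  geg_cubic a N <= (a + 2) * N ^+ 2 * (m + a - 1) ^+ 2.
Proof.
move=> a1 m4; set N := m * (m + a - 1) => /=.
have N0 : 16 <= N.
  have -> : 16 = 4 * 4 :> R by ring.
  by rewrite ler_pM //; lra.
have [a2 a3 a4 a5] : [/\ 1 <= a ^+ 2, 1 <= a ^+ 3, 1 <= a ^+ 4 & 1 <= a ^+ 5].
  by split; apply: exprn_ege1.
pose G := a ^+ 3 / 3 + 2 / 3 * a ^+ 2 - 5 / 3 * a + 2.
pose K := 88 / 3 * a + 74 / 3 * a ^+ 2 + 16 / 3 * a ^+ 3 - 8.
(* The negative linear coefficient is compensated by means of (a - 1)^2 and a (a - 1)^2. *)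
have G0 : 0 <= G.
  have : 0 <= a ^+ 2 - 2 * a + 1.
    have -> : a ^+ 2 - 2 * a + 1 = (a - 1) ^+ 2 by ring.
    exact: sqr_ge0.
  have : 0 <= a ^+ 3 - 2 * a ^+ 2 + a.
    have -> : a ^+ 3 - 2 * a ^+ 2 + a = a * (a - 1) ^+ 2 by ring.
    by rewrite mulr_ge0 ?sqr_ge0 //; lra.
  by rewrite /G; lra.
have K0 : 0 <= K by rewrite /K; lra.
have -> : (a + 2) * N ^+ 2 * (m + a - 1) ^+ 2 = geg_cubic a N
    + (a + 2) * (a - 1) * (m - 4) * N ^+ 2 + G * N ^+ 2 + K * (N - 16)
    + (16 * K - (40 * a + 148 / 3 * a ^+ 2 + 8 * a ^+ 3 - 2 * a ^+ 4
                 - 2 / 3 * a ^+ 5)).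
  by rewrite /geg_cubic /G /K /N; field.
have h1 : 0 <= (a + 2) * (a - 1) * (m - 4) * N ^+ 2.
  by rewrite !mulr_ge0 ?sqr_ge0 //; lra.
have h2 : 0 <= G * N ^+ 2 by rewrite mulr_ge0 ?sqr_ge0.
have h3 : 0 <= K * (N - 16) by rewrite mulr_ge0 //; lra.
have : 0 <= 16 * K - (40 * a + 148 / 3 * a ^+ 2 + 8 * a ^+ 3 - 2 * a ^+ 4
                 - 2 / 3 * a ^+ 5) by rewrite /K; lra.
lra.
Qed.

(** The right side is the square of the upper bound to be proved. [Num.max (a - 1) 0] is 2 lam', so
    the cases a <= 1 and a >= 1 are those of lam <= 0 and lam >= 0. *)
Lemma geg_frobenius_upper a m : 0 < a -> 4 <= m ->
  let N := m * (m + a - 1) in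
  N * geg_cubic a N / (4 * a ^+ 2 * (a + 2) * (a + 4)) <=
  m ^+ 3 * (m + a - 1) ^+ 4 * (m + Num.max (a - 1) 0) / (4 * a ^+ 2 * (a + 4)).
Proof.
move=> a0 m4; set N := m * (m + a - 1) => /=.
have N0 : 0 <= N by rewrite mulr_ge0 //; lra.
have h1 : a != 0 by rewrite gt_eqF.
have h2 : a + 2 != 0 by apply: lt0r_neq0; lra.
have h4 : a + 4 != 0 by apply: lt0r_neq0; lra.
have d0 : 0 < 4 * a ^+ 2 * (a + 2) * (a + 4).
  by rewrite !mulr_gt0 ?exprn_gt0 //; lra.
have -> : m ^+ 3 * (m + a - 1) ^+ 4 * (m + Num.max (a - 1) 0)
      / (4 * a ^+ 2 * (a + 4)) =
    N * ((a + 2) * N ^+ 2 * (m + a - 1) * (m + Num.max (a - 1) 0))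
      / (4 * a ^+ 2 * (a + 2) * (a + 4)).
  by rewrite /N; field; rewrite h1 h2 h4.
rewrite ler_pM2r ?invr_gt0 //; apply: ler_wpM2l => //.
have [a1|/ltW a1] := leP a 1.
  have -> : Num.max (a - 1) 0 = 0 by apply/max_idPr; lra.
  apply: le_trans (geg_cubic_upper_le1 a0 a1 m4) _; rewrite -/N.
  by rewrite le_eqVlt; apply/orP; left; apply/eqP; rewrite /N; ring.
have -> : Num.max (a - 1) 0 = a - 1 by apply/max_idPl; lra.
apply: le_trans (geg_cubic_upper_ge1 a1 m4) _; rewrite -/N.
by rewrite le_eqVlt; apply/orP; left; apply/eqP; ring.
Qed.

Lemma geg_frobenius_lower a m : 0 < a -> 4 <= m ->
  let N := m * (m + a - 1) in
  m * (m + a / 2 - 1) ^+ 2 * (m + a - 1) / (a * (a + 4)) * (N * (N - 2) / (4 * a)) <=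
  N * geg_cubic a N / (4 * a ^+ 2 * (a + 2) * (a + 4)).
Proof.
move=> a0 m4; set N := m * (m + a - 1) => /=.
have N0 : 0 <= N by rewrite mulr_ge0 //; lra.
have h1 : a != 0 by rewrite gt_eqF.
have h2 : a + 2 != 0 by apply: lt0r_neq0; lra.
have h4 : a + 4 != 0 by apply: lt0r_neq0; lra.
have d0 : 0 < 4 * a ^+ 2 * (a + 2) * (a + 4).
  by rewrite !mulr_gt0 ?exprn_gt0 //; lra.
have -> : m * (m + a / 2 - 1) ^+ 2 * (m + a - 1) / (a * (a + 4))
      * (N * (N - 2) / (4 * a)) =
    N * ((a + 2) * N * (N - 2) * (m + a / 2 - 1) ^+ 2)
      / (4 * a ^+ 2 * (a + 2) * (a + 4)).
  by rewrite /N; field; rewrite h1 h2 h4.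
rewrite ler_pM2r ?invr_gt0 //; apply: ler_wpM2l => //.
exact: geg_cubic_lower.
Qed.
End TraceFormulas.

(** * Orthogonality and the Markov inequality for an abstract functional *)

Section GegenbauerFunctional.
Variables (R : realType) (lam : R).
Hypothesis lam_gt : - 2^-1 < lam.
Variable L : {scalar {poly R}}.
Hypothesis L_parts : forall q : {poly R},
  L ((1 - 'X ^+ 2) * q^`() - (2 * lam%:P + 1) * 'X * q) = 0.
Hypothesis L1_gt0 : 0 < L 1.

Local Notation U := (gegU lam).
Local Notation W := (gegW lam).

Lemma L_polyCM c p : L (c%:P * p) = c * L p.
Proof. by rewrite mul_polyC linearZ. Qed.

(* The left side is symmetric in j and k while the eigenvalue j (j + 2 lam) is
   not: this gives orthogonality. *)
Lemma gegW_sturm j k :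
  L ((1 - 'X ^+ 2) * (W j)^`() * (W k)^`()) =
  j%:R * (j%:R + 2 * lam) * L (W j * W k).
Proof.
have := L_parts ((W j)^`() * W k); rewrite derivM.
have -> : (1 - 'X ^+ 2) * ((W j)^`()^`() * W k + (W j)^`() * (W k)^`())
    - (2 * lam%:P + 1) * 'X * ((W j)^`() * W k) =
    (1 - 'X ^+ 2) * (W j)^`() * (W k)^`()
    + (- (j%:R * (j%:R + 2 * lam)))%:P * (W j * W k).
  transitivity ((1 - 'X ^+ 2) * (W j)^`() * (W k)^`()
     + ((1 - 'X ^+ 2) * (W j)^`()^`() - (2 * lam%:P + 1) * 'X * (W j)^`()
     + j%:R * (j%:R + 2 * lam%:P) * W j) * W k
     - (j%:R * (j%:R + 2 * lam%:P)) * (W j * W k)); first by ring.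
  rewrite gegW_ode !(polyCN, polyCM, polyCD, polyC_natr); ring.
by rewrite linearD L_polyCM mulNr => /eqP; rewrite subr_eq0 => /eqP.
Qed.

Lemma gegW_orth j k : j != k -> L (W j * W k) = 0.
Proof.
move=> jk; have := gegW_sturm j k; have := gegW_sturm k j.
rewrite [W k * W j]mulrC mulrAC => -> /eqP; rewrite -subr_eq0 -mulrBl mulf_eq0.
case/orP => [|/eqP //].
have -> : k%:R * (k%:R + 2 * lam) - j%:R * (j%:R + 2 * lam) =
  (k%:R - j%:R) * ((k + j)%:R + 2 * lam) :> R by rewrite natrD; ring.
rewrite mulf_eq0 subr_eq0 eqr_nat eq_sym (negbTE jk) /=.
have l0 := lam_gt.
(* Distinct indices have sum at least 1 while 2 lam > -1, so the eigenvalues differ. *)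
have : 1 <= (k + j)%:R :> R.
  rewrite ler1n; case: k j jk => [|k] [|j] //= _.
by move=> h /eqP; lra.
Qed.

(** Unrolling [gegU_W], [gegU j] is a sum of [gegW i] with i < j and i of parity opposite to j. The
    same unrolling serves the two parity lemmas below. *)
Lemma gegWU_orth j k : (j <= k)%N -> L (W k * U j) = 0.
Proof.
have [m] := ubnP j; elim: m j => // m IHm [|[|j]] jm jk.
- by rewrite gegU0 mulr0 linear0.
- by rewrite gegU1 -[1]/(gegW lam 0) gegW_orth // -lt0n.
- rewrite gegU_W mulrDr linearD IHm ?add0r ?gegW_orth //.
  + by rewrite gtn_eqF.
  + by rewrite -ltnS ltnW.
  + by rewrite (leq_trans _ jk) // ltnW.
Qed.

Lemma gegWU_orth_parity j k : odd j = odd k -> L (W k * U j) = 0.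
Proof.
have [m] := ubnP j; elim: m j => // m IHm [|[|j]] jm jk.
- by rewrite gegU0 mulr0 linear0.
- by rewrite gegU1 -[1]/(gegW lam 0) gegW_orth //; apply/eqP => k0; move: jk; rewrite k0.
- rewrite gegU_W mulrDr linearD IHm ?add0r ?gegW_orth //.
  + by apply/eqP => kj; move: jk; rewrite kj /=; case: odd.
  + by rewrite -ltnS ltnW.
  + by rewrite -jk /= negbK.
Qed.

Lemma gegU_orth_parity j k : odd j != odd k -> L (U j * U k) = 0.
Proof.
have [m] := ubnP j; elim: m j => // m IHm [|[|j]] jm jk.
- by rewrite gegU0 mul0r linear0.
- rewrite gegU1 -[1]/(gegW lam 0) gegWU_orth_parity //.
  by move: jk => /=; case: odd.
- rewrite gegU_W mulrDl linearD IHm ?add0r ?gegWU_orth_parity //.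
  + by move: jk => /=; case: (odd j); case: (odd k).
  + by rewrite -ltnS ltnW.
  + by move: jk => /=; rewrite negbK.
Qed.

(** * Norms and Gram matrices *)

Definition geg_s k := L (U k * U k).
Definition geg_H k := L (W k * W k).

(** The difference of the two [gegU] is a sum of [gegW] of index above k, all orthogonal to
    [gegU k]. *)
Lemma gegU_gram k d : L (U (k + d.*2) * U k) = geg_s k.
Proof.
elim: d => [|d IHd]; first by rewrite addn0.
rewrite doubleS !addnS gegU_W mulrDl linearD IHd gegWU_orth ?addr0 //.
by rewrite -addnS leq_addr.
Qed.

(** Pair the recurrence with [gegU k]: both remaining products equal [geg_s k], and their
    coefficients add up to 2 (k + 1 + lam). Pairing with [gegU k.+2] then gives [geg_s_rec]. *)
Lemma gegU_gramX k : L ('X * U k.+1 * U k) = geg_s k.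
Proof.
have l0 := lam_gt; have k0 : 0 <= k%:R :> R := ler0n _ _.
apply: (@mulfI _ (2 * (k.+1%:R + lam))).
  by apply: lt0r_neq0; rewrite -[k.+1%:R]natr1; lra.
rewrite -L_polyCM.
have -> : (2 * (k.+1%:R + lam))%:P * ('X * U k.+1 * U k) =
   (k.+1%:R)%:P * (U k.+2 * U k) + (k.+1%:R + 2 * lam)%:P * (U k * U k).
  rewrite !(polyCD, polyCM, polyC_natr) !mulrA gegU_rec; ring.
rewrite linearD !L_polyCM -[L (U k * U k)]/(geg_s k).
by have := gegU_gram k 1; rewrite addn2 => ->; ring.
Qed.

Lemma geg_s_rec k :
  k.+1%:R * geg_s k.+2 = 2 * (k.+1%:R + lam) * geg_s k.+1
                         - (k.+1%:R + 2 * lam) * geg_s k.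
Proof.
have /(congr1 (fun x => 2 * (k.+1%:R + lam) * x)) := gegU_gramX k.+1.
rewrite -L_polyCM.
have -> : (2 * (k.+1%:R + lam))%:P * ('X * U k.+2 * U k.+1) =
   (k.+1%:R)%:P * (U k.+2 * U k.+2) + (k.+1%:R + 2 * lam)%:P * (U k.+2 * U k).
  transitivity (U k.+2 * (2 * (k.+1%:R + lam%:P) * 'X * U k.+1
      - (k.+1%:R + 2 * lam%:P) * U k + (k.+1%:R + 2 * lam%:P) * U k)).
    by rewrite !(polyCD, polyCM, polyC_natr); ring.
  by rewrite -gegU_rec !(polyCD, polyCM, polyC_natr); ring.
rewrite linearD !L_polyCM -[L (U k.+2 * U k.+2)]/(geg_s k.+2).
by have := gegU_gram k 1; rewrite addn2 => -> <-; ring.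
Qed.

Lemma geg_s0 : geg_s 0 = 0. Proof. by rewrite /geg_s mul0r linear0. Qed.

(** The second-order recursion propagates this first-order relation, which holds at 0 because
    [geg_s 0] vanishes. *)
Lemma geg_sS k : k%:R * geg_s k.+1 = (k%:R + 2 * lam + 1) * geg_s k.
Proof.
elim: k => [|k IHk]; first by rewrite geg_s0; ring.
rewrite geg_s_rec.
have -> : (k.+1%:R + 2 * lam) * geg_s k = k%:R * geg_s k.+1.
  by rewrite IHk -[k.+1%:R]natr1; ring.
by rewrite -[k.+1%:R]natr1; ring.
Qed.

Lemma geg_s_gt0 k : 0 < geg_s k.+1.
Proof.
elim: k => [|k IHk]; first by rewrite /geg_s gegU1 mulr1.
have := geg_sS k.+1 => E.
have k0 : 0 < k.+1%:R :> R by rewrite ltr0n.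
rewrite -(pmulr_rgt0 _ k0) E mulr_gt0 //.
by have l0 := lam_gt; have := ler0n R k; rewrite -[k.+1%:R]natr1 => ?; lra.
Qed.

Lemma geg_s_ge0 k : 0 <= geg_s k.
Proof. by case: k => [|k]; [rewrite geg_s0 | exact/ltW/geg_s_gt0]. Qed.

(** Positivity of the norms will thus make [geg_s] increase within a parity class, as
    [min_kernel_lower] requires. *)
Lemma geg_HE k : geg_H k.+1 = geg_s k.+2 - geg_s k.
Proof.
have E : W k.+1 = U k.+2 - U k by [].
rewrite /geg_H {2}E mulrBr linearB [L (_ * U k)]gegWU_orth // subr0.
rewrite E mulrBl linearB; congr (_ - _); rewrite mulrC.
by have := gegU_gram k 1; rewrite addn2.
Qed.

Lemma geg_H_s k : k%:R * (k%:R + 2 * lam) * geg_H k =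
                  2 * (2 * lam + 1) * (k%:R + lam) * geg_s k.
Proof.
case: k => [|k]; first by rewrite geg_s0; ring.
rewrite geg_HE.
transitivity ((k.+1%:R + 2 * lam) * (k.+1%:R * geg_s k.+2)
   - k.+1%:R * ((k%:R + 2 * lam + 1) * geg_s k)); first by rewrite -[k.+1%:R]natr1; ring.
by rewrite -geg_sS geg_sS -[k.+1%:R]natr1; ring.
Qed.

Lemma geg_H_gt0 k : 0 < geg_H k.
Proof.
case: k => [|k]; first by rewrite /geg_H mulr1.
have l0 := lam_gt; have k0 := ler0n R k.
have k1 : 0 < k.+1%:R * (k.+1%:R + 2 * lam) :> R.
  by rewrite mulr_gt0 // -[k.+1%:R]natr1; lra.
rewrite -(pmulr_rgt0 _ k1) geg_H_s mulr_gt0 ?geg_s_gt0 //.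
by rewrite mulr_gt0 // -?[k.+1%:R]natr1; lra.
Qed.

Lemma geg_s_le k : geg_s k <= geg_s k.+2.
Proof. by rewrite -subr_ge0 -geg_HE ltW ?geg_H_gt0. Qed.

(** * Splitting into parity blocks *)

Lemma gegW_deriv_gram j k :
  L ((W j)^`() * (W k)^`()) = 4 * (j%:R + lam) * (k%:R + lam) * L (U j * U k).
Proof.
rewrite -L_polyCM; congr (L _); rewrite !gegW_deriv !(polyCD, polyCM, polyC_natr); ring.
Qed.

Lemma gegU_gram_class e i j :
  L (U (i.*2 + e) * U (j.*2 + e)) = geg_s ((minn i j).*2 + e).
Proof.
wlog ij : i j / (j <= i)%N.
  move=> H; case/orP: (leq_total j i) => [/H //|ij].
  by rewrite minnC mulrC; exact: H.
rewrite (minn_idPr ij) -(gegU_gram _ (i - j)); congr (L (U _ * _)).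
by rewrite addnAC -doubleD subnKC.
Qed.

(* For e = 0, 1 the sum runs over the degrees of one parity below 2 N. *)
Definition gegP e N (c : nat -> R) := \sum_(i < N) (c i)%:P * W (i.*2 + e).

Lemma L_gram N (f : nat -> {poly R}) (g : nat -> {poly R}) (c d : nat -> R) :
  L ((\sum_(i < N) (c i)%:P * f i) * (\sum_(j < N) (d j)%:P * g j)) =
  \sum_(i < N) \sum_(j < N) c i * d j * L (f i * g j).
Proof.
rewrite mulr_suml linear_sum; apply: eq_bigr => i _.
rewrite mulr_sumr linear_sum; apply: eq_bigr => j _.
by rewrite mulrACA -polyCM L_polyCM.
Qed.

Lemma deriv_gegP e N c :
  (gegP e N c)^`() = \sum_(i < N) (c i)%:P * (W (i.*2 + e))^`().
Proof.
rewrite /gegP raddf_sum; apply: eq_bigr => i _.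
by rewrite /= derivM derivC mul0r add0r.
Qed.

Lemma gegP_norm2 e N c :
  L (gegP e N c * gegP e N c) = \sum_(i < N) c i ^+ 2 * geg_H (i.*2 + e).
Proof.
rewrite (L_gram N (fun i => W (i.*2 + e)) (fun i => W (i.*2 + e))).
apply: eq_bigr => i _; rewrite (bigD1 i) //= big1 ?addr0 ?expr2 // => j ji.
rewrite gegW_orth ?mulr0 // eqn_add2r; apply: contra ji => /eqP/double_inj/val_inj->.
by [].
Qed.

Lemma gegP_deriv_norm2 e N c :
  L ((gegP e N c)^`() * (gegP e N c)^`()) =
  \sum_(i < N) \sum_(j < N) c i * c j *
     (4 * ((i.*2 + e)%:R + lam) * ((j.*2 + e)%:R + lam)
        * geg_s ((minn i j).*2 + e)).
Proof.
rewrite !deriv_gegP.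
rewrite (L_gram N (fun i => (W (i.*2 + e))^`()) (fun i => (W (i.*2 + e))^`())).
by do 2!(apply: eq_bigr => ? _); rewrite gegW_deriv_gram gegU_gram_class.
Qed.

Lemma gegP_orth N c d : L (gegP 0 N c * gegP 1 N d) = 0.
Proof.
rewrite (L_gram N (fun i => W (i.*2 + 0)) (fun i => W (i.*2 + 1))).
rewrite big1 // => i _; rewrite big1 // => j _; rewrite gegW_orth ?mulr0 //.
by apply/eqP => /(congr1 odd); rewrite !oddD !odd_double.
Qed.

Lemma gegP_deriv_orth N c d : L ((gegP 0 N c)^`() * (gegP 1 N d)^`()) = 0.
Proof.
rewrite !deriv_gegP.
rewrite (L_gram N (fun i => (W (i.*2 + 0))^`()) (fun i => (W (i.*2 + 1))^`())).
rewrite big1 // => i _; rewrite big1 // => j _.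
by rewrite gegW_deriv_gram gegU_orth_parity ?mulr0 // !oddD !odd_double.
Qed.

Lemma gegP_split N (c : nat -> R) :
  \sum_(k < N.*2) (c k)%:P * W k =
  gegP 0 N (fun i => c i.*2) + gegP 1 N (fun i => c i.*2.+1).
Proof.
elim: N => [|N IHN]; first by rewrite /gegP !big_ord0 addr0.
rewrite doubleS !big_ord_recr /= IHN /gegP !big_ord_recr /= addn0 addn1 /=; ring.
Qed.

Lemma gegP_expansion m (p : {poly R}) : (size p <= m.*2)%N ->
  exists c d, p = gegP 0 m c + gegP 1 m d.
Proof.
move=> /(gegW_expansion lam_gt)[c ->].
by exists (fun i => c i.*2), (fun i => c i.*2.+1); rewrite gegP_split.
Qed.

Lemma size_gegP e N c : (e <= 1)%N -> (size (gegP e N c) <= N.*2)%N.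
Proof.
move=> e1; rewrite (leq_trans (size_sum _ _ _)) //; apply/bigmax_leqP => i _.
rewrite mul_polyC (leq_trans (size_scale_leq _ _)) //.
rewrite (leq_trans (size_gegW _ _)) // (@leq_trans i.+1.*2) ?leq_double //.
by rewrite doubleS !ltnS -addn1 leq_add2l.
Qed.

(** * Evaluation of the traces *)

Local Notation a := (2 * lam + 1).
Local Notation r k := (4 * (k%:R + lam) ^+ 2 / geg_H k).

Lemma geg_a_gt0 : 0 < a.
Proof. by have l0 := lam_gt; lra. Qed.

(** The diagonal entry in the basis normalised by [geg_H]. For k > 0, multiplying by 2 a (k + lam)
    lets [geg_H_s] cancel the norm; at k = 0 both sides vanish. *)
Lemma geg_rs k : r k * geg_s k = geg_t a k%:R.
Proof.
have a0 := geg_a_gt0; have H0 : geg_H k != 0 by rewrite gt_eqF ?geg_H_gt0.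
rewrite /geg_t; case: k H0 => [|k] H0; first by rewrite geg_s0; ring.
have x0 : 0 < k.+1%:R + lam.
  by have l0 := lam_gt; have := ler0n R k; rewrite -[k.+1%:R]natr1 => ?; lra.
apply: (@mulfI _ (2 * a * (k.+1%:R + lam))).
  by rewrite !mulf_neq0 // gt_eqF.
transitivity (4 * (k.+1%:R + lam) ^+ 2 / geg_H k.+1 *
    (2 * a * (k.+1%:R + lam) * geg_s k.+1)); first by ring.
rewrite -geg_H_s; field.
by rewrite H0 gt_eqF.
Qed.

Lemma geg_s_two_step k : k%:R * (k%:R + 1) * geg_s k.+2 =
  (k%:R + a) * (k%:R + 1 + a) * geg_s k.
Proof.
have := geg_sS k; have := geg_sS k.+1; rewrite -[k.+1%:R]natr1 => E1 E0.
transitivity (k%:R * ((k%:R + 1) * geg_s k.+2)); first by ring.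
rewrite E1; transitivity ((k%:R + 1 + 2 * lam + 1) * (k%:R * geg_s k.+1)).
  by ring.
by rewrite E0; ring.
Qed.

Lemma sum_geg_rs2 e N : (e <= 1)%N ->
  \sum_(i < N) r (i.*2 + e) * geg_s (i.*2 + e) ^+ 2 =
  geg_s (N.*2 + e) * geg_z a (N.*2 + e)%:R.
Proof.
move=> e1; have a0 := geg_a_gt0; elim: N => [|N IHN].
  rewrite big_ord0 double0 add0n; case: e e1 => [|[|//]] _.
    by rewrite geg_s0 mul0r.
  by rewrite /geg_z subrr !(mulr0, mul0r).
rewrite big_ord_recr /= IHN; set k := (N.*2 + e)%N.
have -> : (N.+1.*2 + e = k.+2)%N by rewrite doubleS !addSn.
rewrite [geg_s k ^+ 2]expr2 [r k * _]mulrA geg_rs.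
have a2 : a + 2 != 0 by apply: lt0r_neq0; lra.
have a4 : a + 4 != 0 by apply: lt0r_neq0; lra.
have a1 : a != 0 by rewrite gt_eqF.
(* The factor (x - 1) (x - 2) of [geg_z] at x = k + 2 is (k + 1) k, exactly the multiplier in
   [geg_s_two_step]. *)
have -> : geg_s k.+2 * geg_z a k.+2%:R = k%:R * (k%:R + 1) * geg_s k.+2 *
    (((k%:R - 1) * (k%:R + 2 + a) / (a + 4) + a / (a + 2)) / a).
  have -> : k.+2%:R = k%:R + 2 :> R by rewrite -addn2 natrD.
  by rewrite /geg_z; field; rewrite a1 a2 a4.
rewrite geg_s_two_step /geg_t /geg_z; field.
by rewrite a1 a2 a4.
Qed.

(** Adding degree k contributes r k (r k s k^2 + 2 s k z k), which is t k (t k + 2 z k) because r k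
    s k = t k. *)
Lemma geg_frobenius e N : (e <= 1)%N ->
  \sum_(i < N) \sum_(j < N) r (i.*2 + e) * r (j.*2 + e)
      * geg_s ((minn i j).*2 + e) ^+ 2 =
  \sum_(i < N) geg_inc a (i.*2 + e)%:R.
Proof.
move=> e1; elim: N => [|N IHN]; first by rewrite !big_ord0.
rewrite (min_kernel_recr N (fun i => r (i.*2 + e)) (fun i => geg_s (i.*2 + e))).
rewrite IHN big_ord_recr /=; congr (_ + _).
rewrite sum_geg_rs2 // /geg_inc -geg_rs; ring.
Qed.

(** * Markov inequalities for the functional *)

Lemma L_sqr_orth (u v : {poly R}) : L (u * v) = 0 ->
  L ((u + v) * (u + v)) = L (u * u) + L (v * v).
Proof.
move=> uv; have -> : (u + v) * (u + v) = u * u + 2%:P * (u * v) + v * v.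
  by rewrite polyC_natr; ring.
by rewrite !linearD L_polyCM uv mulr0 addr0.
Qed.

Lemma gegP_markov e N c (B : R) : (e <= 1)%N -> 0 <= B ->
    \sum_(i < N) geg_inc a (i.*2 + e)%:R <= B ^+ 2 ->
  L ((gegP e N c)^`() * (gegP e N c)^`()) <= B * L (gegP e N c * gegP e N c).
Proof.
move=> e1 B0 TB; rewrite gegP_deriv_norm2 gegP_norm2.
have S0 : 0 <= \sum_(i < N) c i ^+ 2 * geg_H (i.*2 + e).
  by apply: sumr_ge0 => i _; rewrite mulr_ge0 ?sqr_ge0 // ltW ?geg_H_gt0.
apply: le_trans (ler_norm _) _.
rewrite -(ger0_norm (mulr_ge0 B0 S0)) -ler_sqr ?nnegrE // !real_normK ?num_real //.
apply: le_trans (min_kernel_upper N (fun i => (i.*2 + e)%:R + lam)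
  (fun i => geg_s (i.*2 + e)) c (fun i => geg_H_gt0 (i.*2 + e))) _.
by rewrite geg_frobenius // exprMn ler_wpM2r // sqr_ge0.
Qed.

(** The two parity classes stay orthogonal after differentiation, so a constant valid on each block
    is valid on the sum. *)
Lemma markov_upper M (p : {poly R}) (B : R) : (size p <= M.*2)%N -> 0 <= B ->
    \sum_(i < M) geg_inc a (i.*2 + 1)%:R <= B ^+ 2 ->
  L (p^`() * p^`()) <= B * L (p * p).
Proof.
move=> /gegP_expansion [c [d ->]] B0 TB.
rewrite derivD !L_sqr_orth ?gegP_orth ?gegP_deriv_orth // mulrDr.
apply: lerD; apply: gegP_markov => //.
apply: le_trans TB; apply: ler_sum => i _.
exact/geg_inc_even_le_odd/geg_a_gt0.
Qed.

(** The admissible constant is tested only on combinations of the [gegW] of odd degree. *)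
Lemma markov_lower M (C : R) :
    (forall p : {poly R}, (size p <= M.*2)%N -> L (p^`() * p^`()) <= C * L (p * p)) ->
  \sum_(i < M) geg_inc a (i.*2 + 1)%:R <= C * \sum_(i < M) geg_t a (i.*2 + 1)%:R.
Proof.
move=> HC; rewrite -geg_frobenius //.
under [X in _ <= C * X]eq_bigr do rewrite -geg_rs.
apply: (min_kernel_lower (x := fun i => (i.*2 + 1)%:R + lam)
  (H := fun i => geg_H (i.*2 + 1)) (s := fun i => geg_s (i.*2 + 1))).
- by move=> i; exact: geg_H_gt0.
- exact: geg_s_ge0.
- by move=> i; rewrite doubleS !addSn; exact: geg_s_le.
- move=> c; rewrite -gegP_norm2 -gegP_deriv_norm2; apply: HC; exact: size_gegP.
Qed.

Lemma gegP_norm2_ge0 e N c : 0 <= L (gegP e N c * gegP e N c).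
Proof.
rewrite gegP_norm2; apply: sumr_ge0 => i _.
by rewrite mulr_ge0 ?sqr_ge0 // ltW ?geg_H_gt0.
Qed.

Lemma gegP_norm2_eq0 e N c : L (gegP e N c * gegP e N c) = 0 -> gegP e N c = 0.
Proof.
rewrite gegP_norm2 => /eqP; rewrite psumr_eq0 => [/allP c0|i _]; last first.
  by rewrite mulr_ge0 ?sqr_ge0 // ltW ?geg_H_gt0.
rewrite /gegP big1 // => i _; have := c0 i (mem_index_enum _).
by rewrite /= mulf_eq0 sqrf_eq0 (gt_eqF (geg_H_gt0 _)) orbF => /eqP ->; rewrite mul0r.
Qed.

(** Definiteness follows from the orthogonal expansion and the positive norms [geg_H]. *)
Lemma L_sqr_gt0 (p : {poly R}) : p != 0 -> 0 < L (p * p).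
Proof.
have : (size p <= (size p).*2)%N by rewrite -addnn leq_addr.
move=> /gegP_expansion [c [d ->]] nz; rewrite L_sqr_orth ?gegP_orth //.
rewrite lt_neqAle addr_ge0 ?gegP_norm2_ge0 // andbT eq_sym.
apply: contra nz; rewrite paddr_eq0 ?gegP_norm2_ge0 //.
by move=> /andP[/eqP/gegP_norm2_eq0-> /eqP/gegP_norm2_eq0->]; rewrite addr0.
Qed.
End GegenbauerFunctional.

(** * The Gegenbauer weight *)

Section GegenbauerWeight.
Variables (R : realType) (lam : R).
Hypothesis lam_gt : - 2^-1 < lam.

Local Notation mu := (@lebesgue_measure R).
Local Notation w := (gweight lam).
Local Notation s := (lam + 2^-1).

Lemma one_sub_sqr_gt0 (x : R) : -1 < x < 1 -> 0 < 1 - x ^+ 2.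
Proof.
move=> /andP[x0 x1]; have -> : 1 - x ^+ 2 = (1 - x) * (1 + x) by ring.
by rewrite mulr_gt0; lra.
Qed.

Lemma gweight_ge0 x : 0 <= w x.
Proof. exact: powR_ge0. Qed.

Lemma gweightM x : -1 < x < 1 -> (1 - x ^+ 2) * w x = (1 - x ^+ 2) `^ s.
Proof.
move=> /one_sub_sqr_gt0 x0; have l0 := lam_gt.
rewrite -[RHS]mulr_powRB1 ?ltW //; last by lra.
by congr (_ * _ `^ _); lra.
Qed.

(** Used twice: k = 0 gives integration by parts, and a positive k with q = - X / (2 lam + 1) gives
    a majorant of the weight. *)
Definition gweight_prim (q : {poly R}) (k : R) (t : R) :=
  (1 - t ^+ 2) `^ s * q.[t] + k * t.

Definition gweight_dprim (q : {poly R}) (k : R) (t : R) :=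
  w t * ((1 - 'X ^+ 2) * q^`() - (2 * lam%:P + 1) * 'X * q).[t] + k.

Lemma is_derive_gweight_prim (q : {poly R}) (k x : R) : -1 < x < 1 ->
  is_derive x (1 : R) (gweight_prim q k) (gweight_dprim q k x).
Proof.
move=> x1; have x0 := one_sub_sqr_gt0 x1.
have E : 1 - x ^+ 2 = (1 - 'X ^+ 2 : {poly R}).[x] by rewrite !hornerE.
have d1 : is_derive x (1 : R) (fun t => (1 - t ^+ 2) `^ s)
    ((s * (1 - x ^+ 2) `^ (s - 1)) * (1 - 'X ^+ 2 : {poly R})^`().[x]).
  have -> : (fun t => (1 - t ^+ 2) `^ s) =
      (@powR R ^~ s) \o (horner (1 - 'X ^+ 2 : {poly R})).
    by apply/funext => t /=; rewrite !hornerE.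
  apply: is_derive1_comp; rewrite -E.
  exact: is_derive1_powR.
have d2 : is_derive x (1 : R) (fun t : R => k * t) k.
  have -> : (fun t : R => k * t) = horner (k%:P * 'X).
    by apply/funext => t; rewrite !hornerE.
  apply: is_derive_eq.
  by rewrite derivM derivC derivX !hornerE.
have -> : gweight_prim q k =
   ((fun t => (1 - t ^+ 2) `^ s) * horner q) + (fun t => k * t).
  by apply/funext.
apply: is_derive_eq.
rewrite /gweight_dprim /w /gweight.
have -> : lam + 2^-1 - 1 = lam - 2^-1 by lra.
have -> : (1 - x ^+ 2) `^ (lam + 2^-1) = (1 - x ^+ 2) * (1 - x ^+ 2) `^ (lam - 2^-1).
  by rewrite -gweightM.
rewrite derivB derivXn -polyC1 derivC !hornerE /= /GRing.scale /=.
by field.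
Qed.

Lemma continuous_gweight x : -1 < x < 1 -> {for x, continuous w}.
Proof.
move=> x1; have x0 := one_sub_sqr_gt0 x1.
have -> : w = (@powR R ^~ (lam - 2^-1)) \o (horner (1 - 'X ^+ 2 : {poly R})).
  by apply/funext => t /=; rewrite !hornerE.
apply: continuous_comp; first exact: continuous_horner.
apply/differentiable_continuous/derivable1_diffP.
by apply: derivable_powR; rewrite !hornerE in_itv /= andbT.
Qed.

Lemma measurable_gweight (D : set R) : measurable D -> measurable_fun D w.
Proof.
move=> mD; apply: measurable_funTS.
have -> : w = (@powR R ^~ (lam - 2^-1)) \o (horner (1 - 'X ^+ 2 : {poly R})).
  by apply/funext => t /=; rewrite !hornerE.
apply: measurableT_comp; first exact: measurable_powR.
by apply: continuous_measurable_fun; exact: continuous_horner.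
Qed.

Lemma measurable_gweight_poly (D : set R) (p : {poly R}) :
  measurable D -> measurable_fun D (fun t => w t * p.[t]).
Proof.
move=> mD; apply: measurable_funM; first exact: measurable_gweight.
by apply: measurable_funTS; apply: continuous_measurable_fun; exact: continuous_horner.
Qed.

Lemma itv_sub1 (b x : R) : b < 1 -> x \in `[- b, b] -> -1 < x < 1.
Proof. by move=> b1; rewrite in_itv /= => /andP[? ?]; lra. Qed.

Lemma integral_gweight_dprim (q : {poly R}) (k b : R) : 0 < b < 1 ->
  (\int[mu]_(t in `[(- b)%R, b]) (gweight_dprim q k t)%:E =
   (gweight_prim q k b - gweight_prim q k (- b))%R%:E)%E.
Proof.
move=> /andP[b0 b1].
have cont x : -1 < x < 1 -> {for x, continuous (gweight_prim q k)}.
  move=> x1; apply/differentiable_continuous/derivable1_diffP.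
  by apply: ex_derive; exact: is_derive_gweight_prim.
rewrite EFinB; apply: continuous_FTC2.
- by lra.
- apply: continuous_in_subspaceT => x; rewrite inE /= => /(itv_sub1 b1) x1.
  rewrite /gweight_dprim; apply: cvgD; last exact: cvg_cst.
  by apply: cvgM; [exact: continuous_gweight | exact: continuous_horner].
- split.
  + move=> x xb; apply: ex_derive; apply: is_derive_gweight_prim.
    by move: xb; rewrite in_itv /= => /andP[? ?]; lra.
  + by apply: cvg_at_right_filter; apply: cont; lra.
  + by apply: cvg_at_left_filter; apply: cont; lra.
- move=> x xb; rewrite derive1E.
  have x1 : -1 < x < 1 by move: xb; rewrite in_itv /= => /andP[? ?]; lra.
  by have [_ ->] := is_derive_gweight_prim q k x1.
Qed.

(* The intervals [- exh n, exh n] exhaust ]-1, 1[, where the weight may be unbounded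
   near the endpoints. *)
Definition exh (n : nat) : R := 1 - n.+2%:R^-1.

Lemma exh_itv n : 0 < exh n < 1.
Proof.
rewrite /exh subr_gt0 gtrBl invr_gt0 ltr0n andbT.
by rewrite invf_lt1 ?ltr0n // ltr1n.
Qed.

Local Notation E n := (`[- exh n, exh n]%classic).
Local Notation I := (`](-1 : R), 1[%classic).

Lemma exh_le m n : (m <= n)%N -> exh m <= exh n.
Proof.
by move=> mn; rewrite lerD2l lerN2 lef_pV2 ?posrE ?ltr0n // ler_nat.
Qed.

Lemma nondecreasing_exh : nondecreasing_seq (fun n => E n).
Proof.
move=> m n mn; apply/subsetPset => x /=; rewrite !in_itv /= => /andP[? ?].
by have := exh_le mn => ?; lra.
Qed.

Lemma bigcup_exh : \bigcup_n E n = I.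
Proof.
apply/seteqP; split => [x [n _] /=|x /=].
  have /andP[b0 b1] := exh_itv n.
  by rewrite !in_itv /= => /andP[? ?]; lra.
rewrite in_itv /= => /andP[x0 x1].
have d0 : 0 < 1 - `|x| by rewrite subr_gt0 ltr_norml x0.
(* This index n has n + 1 > 1 / (1 - |x|), hence |x| <= [exh n]. *)
exists (Num.truncn (1 - `|x|)^-1) => //=.
have : `|x| <= exh (Num.truncn (1 - `|x|)^-1).
  rewrite /exh lerBrDl -lerBrDr -[leRHS]invrK lef_pV2 ?posrE ?ltr0n ?invr_gt0 //.
  apply/ltW/(lt_trans (truncnS_gt _)); by rewrite ltr_nat.
by rewrite ler_norml in_itv.
Qed.

(** On each compact interval the weight lies below an explicit derivative whose integral is at most
    2 k, the boundary term of [q] being nonpositive. Monotone convergence carries this uniform bound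
    to the open interval. *)
Lemma integrable_gweight : mu.-integrable I (EFin \o w).
Proof.
have l0 := lam_gt.
apply/integrableP; split.
  by apply/measurable_EFinP; exact: measurable_gweight.
have -> : (\int[mu]_(x in I) `|(EFin \o w) x| = \int[mu]_(x in I) (w x)%:E)%E.
  by apply: eq_integral => x _ /=; rewrite ger0_norm ?gweight_ge0.
pose a := 2 * lam + 1; have a0 : 0 < a by rewrite /a; lra.
pose k := (2 * lam + 2) / a; have k0 : 0 < k by rewrite divr_gt0 //; lra.
have bnd n : (\int[mu]_(t in E n) (w t)%:E <= (2 * k)%R%:E)%E.
  have /andP[b0 b1] := exh_itv n.
  (* a w = (2 lam + 2) (1 - t^2) w - (t (1 - t^2)^s)', and (1 - t^2) w <= 1. *)
  pose q := (- a^-1)%:P * 'X : {poly R}.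
  have w_le x : x \in `[- exh n, exh n] -> w x <= gweight_dprim q k x.
    move=> /(itv_sub1 b1) x1; have x0 := one_sub_sqr_gt0 x1.
    have : (1 - x ^+ 2) * w x <= 1.
      rewrite gweightM // -[leRHS](powRr0 (1 - x ^+ 2)) ger_powR //; last by lra.
      by rewrite x0 gerBl sqr_ge0.
    rewrite -subr_ge0 => ws; rewrite -subr_ge0.
    suff -> : gweight_dprim q k x - w x = k * (1 - (1 - x ^+ 2) * w x).
      by rewrite mulr_ge0 // ltW.
    rewrite /gweight_dprim /q derivM derivC derivX !hornerE /= /k.
    have -> : 2 * lam + 2 = a + 1 by rewrite /a; ring.
    have -> : 2 * lam + 1 = a by [].
    by field; rewrite gt_eqF.
  apply: (@le_trans _ _ (\int[mu]_(t in E n) (gweight_dprim q k t)%:E)%E).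
    apply: ge0_le_integral => //=.
    + by move=> x _; rewrite lee_fin gweight_ge0.
    + by apply/measurable_EFinP; exact: measurable_gweight.
    + apply/measurable_EFinP/measurable_funD => //.
      exact: measurable_gweight_poly.
  rewrite integral_gweight_dprim ?b0 // lee_fin.
  pose P := (1 - exh n ^+ 2) `^ s; have P0 : 0 <= P by exact: powR_ge0.
  have -> : gweight_prim q k (exh n) - gweight_prim q k (- exh n) =
      2 * (k * exh n) - 2 * (P * (a^-1 * exh n)).
    by rewrite /gweight_prim sqrrN -/P /q 2!hornerCM !hornerX; ring.
  have h1 : 0 <= P * (a^-1 * exh n) by rewrite !mulr_ge0 // ?invr_ge0 ltW.
  have h2 : k * exh n <= k by rewrite ger_pMr // ltW.
  move: (k * exh n) (P * _) h1 h2 => u v; lra.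
apply: (@le_lt_trans _ _ (2 * k)%R%:E); last exact: ltry.
rewrite -bigcup_exh.
have cv : (\int[mu]_(x in E n) (w x)%:E)%E @[n --> \oo] -->
          (\int[mu]_(x in \bigcup_n E n) (w x)%:E)%E.
  apply: ge0_nondecreasing_set_cvg_integral => //.
  - exact: nondecreasing_exh.
  - by move=> n; apply/measurable_EFinP; exact: measurable_gweight.
  - by move=> n x _; rewrite lee_fin gweight_ge0.
rewrite -(cvg_lim _ cv) //; apply: lime_le; first by apply/cvg_ex; eexists; exact: cv.
exact: nearW.
Qed.

Lemma integrable_gweight_poly (p : {poly R}) :
  mu.-integrable I (fun t => (w t * p.[t])%:E).
Proof.
have [C pC] := poly_itv_bound p (-1) 1.
apply: (le_integrable _ _ _ (integrableZl _ C integrable_gweight)) => //.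
  by apply/measurable_EFinP; exact: measurable_gweight_poly.
move=> x /=; rewrite in_itv /= => /andP[x0 x1].
rewrite lee_fin !normrM mulrC ler_wpM2r //.
by rewrite (le_trans _ (ler_norm _)) // pC // !ltW.
Qed.

(** Dominated convergence for the restrictions to the compact intervals, with |w p| as majorant. *)
Lemma cvg_integral_exh (p : {poly R}) :
  (\int[mu]_(t in E n) (w t * p.[t])%:E)%E @[n --> \oo] -->
  (\int[mu]_(t in I) (w t * p.[t])%:E)%E.
Proof.
have ip := integrable_gweight_poly p.
have [] := @dominated_convergence _ _ _ mu I _
  (fun n => (fun t => (w t * p.[t])%:E) \_ (E n)) (fun t => (w t * p.[t])%:E)
  (fun t => `|(w t * p.[t])%:E|%E).
- by [].
- move=> n; apply/(measurable_restrict _ _ _).1 => //.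
  by apply/measurable_EFinP; apply: measurable_gweight_poly; exact: measurableI.
- by apply/measurable_EFinP; exact: measurable_gweight_poly.
- apply: aeW => x Ix; apply: cvg_near_cst.
  have [N _ EN] : (\bigcup_n E n) x by rewrite bigcup_exh.
  near=> n; rewrite patchE mem_set //.
  have /nondecreasing_exh/subsetPset : (N <= n)%N by near: n; exact: nbhs_infty_ge.
  exact.
- exact: integrable_abse.
- apply: aeW => x n _; rewrite patchE; case: ifP => // _.
  by rewrite abse0 abse_ge0.
move=> _ _; apply: cvg_trans.
have -> // : (fun n => \int[mu]_(t in E n) (w t * p.[t])%:E)%E =
  [sequence (\int[mu]_(x in I) ((fun t => (w t * p.[t])%:E) \_ (E n)) x)%E]_n.
apply/funext => n /=; rewrite -integral_mkcondr setIC setIidl // => x.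
by rewrite -bigcup_exh => xE; exists n.
Unshelve. all: by end_near. Qed.

(** 1 - [exh n]^2 = (1 + [exh n]) / (n + 2) <= 2 / (n + 1), and the exponent is positive. *)
Lemma cvg_exh_powR : (1 - exh n ^+ 2) `^ s @[n --> \oo] --> 0.
Proof.
have l0 := lam_gt; have s0 : 0 < s by lra.
apply: (@squeeze_cvgr _ _ _ _ (cst 0) (fun n => (2 * harmonic n) `^ s)).
- apply: nearW => n; rewrite powR_ge0 /=; have /andP[b0 b1] := exh_itv n.
  have h0 : 0 <= 1 - exh n ^+ 2 by rewrite ltW // one_sub_sqr_gt0 //; lra.
  have h1 : 0 <= 2 * harmonic n :> R by rewrite mulr_ge0 ?harmonic_ge0.
  apply: ge0_ler_powR; rewrite ?nnegrE ?(ltW s0) //.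
  have -> : 1 - exh n ^+ 2 = (1 + exh n) * n.+2%:R^-1.
    by rewrite /exh; ring.
  rewrite ler_pM ?invr_ge0 //; try lra.
  by rewrite lef_pV2 ?posrE ?ltr0n // ler_nat.
- exact: cvg_cst.
- have /cvg_at_rightP := powR_cvg0 s0; apply; split => [n|].
    by rewrite mulr_gt0 ?harmonic_gt0.
  rewrite -[X in _ --> X](mulr0 2); apply: cvgMr; exact: cvg_harmonic.
Qed.

(** On the n-th interval only boundary terms remain; with [C] bounding q they are at most 2 C (1 -
    [exh n]^2)^(lam + 1/2), which tends to 0. *)
Lemma integral_gweight_parts (q : {poly R}) :
  (\int[mu]_(t in I)
     (w t * ((1 - 'X ^+ 2) * q^`() - (2 * lam%:P + 1) * 'X * q).[t])%:E = 0)%E.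
Proof.
rewrite -(cvg_lim _ (@cvg_integral_exh _)) //; apply/cvg_lim => //.
have -> : (fun n => \int[mu]_(t in E n)
    (w t * ((1 - 'X ^+ 2) * q^`() - (2 * lam%:P + 1) * 'X * q).[t])%:E)%E =
  (fun n => (gweight_prim q 0 (exh n) - gweight_prim q 0 (- exh n))%:E).
  apply/funext => n; rewrite -integral_gweight_dprim ?exh_itv //.
  by apply: eq_integral => x _; rewrite /gweight_dprim addr0.
apply: cvg_EFin; first exact: nearW.
have [C qC] := poly_itv_bound q (-1) 1.
have cv : (1 - exh n ^+ 2) `^ s * (2 * C) @[n --> \oo] --> 0.
  by rewrite -[X in _ --> X](mul0r (2 * C)); apply: cvgMl; exact: cvg_exh_powR.
apply/norm_cvg0P; apply: (@squeeze_cvgr _ _ _ _ (cst 0) _ _ _ _ (cvg_cst _) cv).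
apply: nearW => n /=; rewrite normr_ge0 /=.
have /andP[b0 b1] := exh_itv n.
have -> : gweight_prim q 0 (exh n) - gweight_prim q 0 (- exh n) =
    (1 - exh n ^+ 2) `^ s * (q.[exh n] - q.[- exh n]).
  by rewrite /gweight_prim sqrrN; ring.
rewrite normrM ger0_norm ?powR_ge0 // ler_wpM2l ?powR_ge0 //.
rewrite (le_trans (ler_normB _ _)) // mulr_natl mulr2n lerD // qC //; lra.
Qed.

Lemma integral_gweight_gt0 : (0 < \int[mu]_(t in I) (w t)%:E)%E.
Proof.
(* Replacing the exponent by its nonnegative part lowers a power of 1 - x^2 in [3/4, 1], and makes
   it monotone in the base; so [c] bounds the weight below on [-1/2, 1/2]. *)
pose e := Num.max (lam - 2^-1) 0; pose c := (3 / 4 : R) `^ e.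
have c0 : 0 < c by apply: powR_gt0; lra.
have e0 : 0 <= e by rewrite le_max lexx orbT.
apply: (@lt_le_trans _ _ (\int[mu]_(t in `[(- 2^-1)%R, (2^-1)%R]) (cst c%:E t))%E).
  rewrite integral_cst //= lebesgue_measure_itv /= lte_fin.
  rewrite ifT; last lra.
  by rewrite -EFinB -EFinM lte_fin mulr_gt0 //; lra.
apply: (@le_trans _ _ (\int[mu]_(t in `[(- 2^-1)%R, (2^-1)%R]) (w t)%:E)%E).
  apply: ge0_le_integral => //=.
  - by move=> x _; rewrite lee_fin ltW.
  - by apply/measurable_EFinP; exact: measurable_gweight.
  move=> x; rewrite in_itv /= => /andP[x0 x1]; rewrite lee_fin.
  have x2 : x ^+ 2 <= 1 / 4.
    have : 0 <= (2^-1 - x) * (2^-1 + x) by rewrite mulr_ge0 //; lra.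
    have -> : (2^-1 - x) * (2^-1 + x) = 1 / 4 - x ^+ 2 by field.
    lra.
  have x3 : 0 <= x ^+ 2 by rewrite sqr_ge0.
  apply: (@le_trans _ _ ((1 - x ^+ 2) `^ e)).
    by apply: ge0_ler_powR; rewrite ?nnegrE //; lra.
  by apply: ger_powR; [lra | rewrite le_max lexx].
apply: ge0_subset_integral => //=.
- by apply/measurable_EFinP; exact: measurable_gweight.
- by move=> x _; rewrite lee_fin gweight_ge0.
- by move=> x /=; rewrite !in_itv /= => /andP[? ?]; lra.
Qed.

(** * The functional given by the weight *)

Definition gegL (p : {poly R}) : R := fine (\int[mu]_(t in I) (w t * p.[t])%:E)%E.

Lemma gegL_EFin p : (\int[mu]_(t in I) (w t * p.[t])%:E = (gegL p)%:E)%E.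
Proof. by rewrite fineK // integrable_fin_num // integrable_gweight_poly. Qed.

Lemma gegL_scalar : scalar gegL.
Proof.
move=> k p q; apply: EFin_inj; rewrite EFinD EFinM -!gegL_EFin.
rewrite -integralZl //; last exact: integrable_gweight_poly.
rewrite -integralD //; last exact: integrable_gweight_poly.
  by apply: eq_integral => x _; rewrite -EFinM -EFinD hornerD hornerZ; congr (_%:E); ring.
exact/integrableZl/integrable_gweight_poly.
Qed.

Lemma gegL1_gt0 : 0 < gegL 1.
Proof.
rewrite -lte_fin -gegL_EFin.
have := integral_gweight_gt0; congr (_ < _)%E.
by apply: eq_integral => x _; rewrite hornerE mulr1.
Qed.

Lemma gegL_parts (q : {poly R}) :
  gegL ((1 - 'X ^+ 2) * q^`() - (2 * lam%:P + 1) * 'X * q) = 0.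
Proof. by rewrite /gegL integral_gweight_parts. Qed.

Lemma wnorm2_poly (p : {poly R}) : wnorm2 lam (fun t => p.[t]) = gegL (p * p).
Proof.
rewrite /wnorm2 /gegL; congr (fine _); apply: eq_integral => x _.
by rewrite hornerM expr2.
Qed.

End GegenbauerWeight.

(** * The Markov constant *)

Section MarkovConstant.
Variables (R : realType) (lam : R).
Hypothesis lam_gt : - 2^-1 < lam.

Local Notation L := (gegL lam).
Local Notation a := (2 * lam + 1).

(** Linearity depends on [lam_gt], so the linear structure is provided existentially; rewriting
    along the equality transports the abstract results to [gegL]. *)
Lemma gegL_linear : exists f : {scalar {poly R}}, f = L :> (_ -> _).
Proof.
pose lin := GRing.isLinear.Build R {poly R} R *%R L (gegL_scalar lam_gt).
pose f : {scalar {poly R}} := HB.pack L lin.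
by exists f.
Qed.

Lemma gegL_sqr_gt0 (p : {poly R}) : p != 0 -> 0 < L (p * p).
Proof.
have [f fE] := gegL_linear; rewrite -fE; apply: (@L_sqr_gt0 _ lam) => //.
  by move=> q; rewrite fE gegL_parts.
by rewrite fE gegL1_gt0.
Qed.

Lemma gegL_markov_upper M (p : {poly R}) (B : R) : (size p <= M.*2)%N -> 0 <= B ->
    \sum_(i < M) geg_inc a (i.*2 + 1)%:R <= B ^+ 2 ->
  L (p^`() * p^`()) <= B * L (p * p).
Proof.
have [f fE] := gegL_linear; rewrite -fE; apply: markov_upper => //.
  by move=> q; rewrite fE gegL_parts.
by rewrite fE gegL1_gt0.
Qed.

Lemma gegL_markov_lower M (C : R) :
    (forall p : {poly R}, (size p <= M.*2)%N -> L (p^`() * p^`()) <= C * L (p * p)) ->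
  \sum_(i < M) geg_inc a (i.*2 + 1)%:R <= C * \sum_(i < M) geg_t a (i.*2 + 1)%:R.
Proof.
have [f fE] := gegL_linear; rewrite -fE; apply: markov_lower => //.
  by move=> q; rewrite fE gegL_parts.
by rewrite fE gegL1_gt0.
Qed.

Lemma gegL_sqr_ge0 (p : {poly R}) : 0 <= L (p * p).
Proof.
have [->|/gegL_sqr_gt0/ltW //] := eqVneq p 0.
by have [f fE] := gegL_linear; rewrite -fE mulr0 linear0.
Qed.

Lemma markov_ratio (p : {poly R}) :
  wnorm lam (fun t => p^`().[t]) / wnorm lam (fun t => p.[t]) =
  Num.sqrt (L (p^`() * p^`()) / L (p * p)).
Proof. by rewrite /wnorm !wnorm2_poly sqrtrM ?gegL_sqr_ge0 // sqrtrV ?gegL_sqr_ge0. Qed.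

(** An a priori constant [B] makes the extended-real supremum finite, with values in [0, sqrt B];
    its square is then itself an admissible constant. *)
Lemma markov_const_spec n (B : R) : 0 <= B ->
    (forall p : {poly R}, (size p <= n.+1)%N -> L (p^`() * p^`()) <= B * L (p * p)) ->
  exists C : R, [/\ (markov_const n lam * markov_const n lam = C%:E)%E, C <= B &
    forall p : {poly R}, (size p <= n.+1)%N -> L (p^`() * p^`()) <= C * L (p * p)].
Proof.
move=> B0 HB; set c := markov_const n lam.
have ub (p : {poly R}) : (size p <= n.+1)%N -> p != 0 ->
    ((Num.sqrt (L (p^`() * p^`()) / L (p * p)))%:E <= c)%E.
  by move=> sp p0; apply: ereal_sup_ubound; exists p => //; rewrite markov_ratio.
have c0 : (0 <= c)%E.
  (* The constant polynomial 1 shows that the supremum is over a nonempty set. *)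
  apply: le_trans (ub 1 _ _); rewrite ?lee_fin ?sqrtr_ge0 ?size_poly1 ?oner_neq0 //.
have cB : (c <= (Num.sqrt B)%:E)%E.
  apply: ge_ereal_sup => _ [p [sp p0] <-]; rewrite lee_fin markov_ratio.
  by rewrite ler_wsqrtr // ler_pdivrMr ?gegL_sqr_gt0 // HB.
have cfin : c \is a fin_num.
  by rewrite ge0_fin_numE // (le_lt_trans cB) // ltry.
have cE : c = (fine c)%:E by rewrite fineK.
have r0 : 0 <= fine c by rewrite -lee_fin -cE.
exists (fine c ^+ 2); split.
- by rewrite {1 2}cE -EFinM expr2.
- by rewrite -[leRHS](sqr_sqrtr B0) ler_sqr ?nnegrE ?sqrtr_ge0 // -lee_fin -cE.
move=> p sp; have [->|p0] := eqVneq p 0.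
  by have [f fE] := gegL_linear; rewrite -fE deriv0 mulr0 linear0 mulr0.
have := ub p sp p0; rewrite cE lee_fin => h.
rewrite -ler_pdivrMr ?gegL_sqr_gt0 //.
rewrite -[leLHS]sqr_sqrtr ?divr_ge0 ?gegL_sqr_ge0 //.
by rewrite ler_sqr ?nnegrE ?sqrtr_ge0.
Qed.
End MarkovConstant.

Theorem theorem4p4 (R : realType) (n : nat) (lam : R) :
  odd n -> (3 <= n)%N -> - 2^-1 < lam ->
  let lam' := Num.max lam 0 in
  let c := markov_const n lam in
  (((n.+1%:R * (n%:R + lam + 2^-1) ^+ 2 * (n%:R + 2 * lam + 1))
      / ((2 * lam + 1) * (2 * lam + 5)))%:E <= c * c
   /\ c * c <=
   ((n.+1%:R `^ (3 / 2) * (n%:R + 2 * lam + 1) ^+ 2 * Num.sqrt (n%:R + 2 * lam' + 1))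
      / (2 * (2 * lam + 1) * Num.sqrt (2 * lam + 5)))%:E)%E.
Proof.
move=> n_odd n3 lam_gt lam' c.
(* Degree at most n means size at most 2 M: the indices 0, ..., n split into M of each parity. *)
pose M := n.+1./2.
have nM : n.+1 = M.*2 by rewrite -[LHS]odd_double_half /= n_odd.
pose m : R := n.+1%:R; pose a := 2 * lam + 1.
have m4 : 4 <= m by rewrite ler_nat.
have a0 : 0 < a by rewrite /a; lra.
have nE : n%:R = m - 1 by rewrite /m -natr1 addrK.
have -> : n%:R + lam + 2^-1 = m + a / 2 - 1 by rewrite nE /a; field.
have -> : n%:R + 2 * lam + 1 = m + a - 1 by rewrite nE /a; ring.
have -> : n%:R + 2 * lam' + 1 = m + Num.max (a - 1) 0.
  have -> : a - 1 = 2 * lam by rewrite /a; ring.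
  by rewrite -[X in Num.max _ X](mulr0 2) -maxr_pMr // -/lam' nE; ring.
have -> : 2 * lam + 5 = a + 4 by rewrite /a; ring.
rewrite -/m -/a; set B := (X in _ /\ (_ <= X%:E)%E).
have l0 : 0 <= Num.max (a - 1) 0 by rewrite le_max lexx orbT.
have B0 : 0 <= B.
  rewrite divr_ge0 ?mulr_ge0 ?powR_ge0 ?sqr_ge0 ?sqrtr_ge0 //; lra.
(* With m = n + 1 and a = 2 lam + 1, the bound of [geg_frobenius_upper] is exactly [B ^+ 2]. *)
have TB : \sum_(i < M) geg_inc a (i.*2 + 1)%:R <= B ^+ 2.
  rewrite sum_geg_inc //= -nM -/m.
  apply: le_trans (geg_frobenius_upper a0 m4) _; rewrite /B.
  rewrite [(_ / _) ^+ 2]expr_div_n !exprMn !sqr_sqrtr; [|lra|lra].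
  rewrite -[(m `^ (3 / 2)) ^+ 2]powR_mulrn ?powR_ge0 // -powRrM.
  have -> : 3 / 2 * 2%:R = 3%:R :> R by field.
  rewrite powR_mulrn; last lra.
  by rewrite -exprD; have -> : 2 ^+ 2 = 4 :> R by ring.
have HB (p : {poly R}) : (size p <= n.+1)%N ->
    gegL lam (p^`() * p^`()) <= B * gegL lam (p * p).
  by rewrite nM => sp; apply: (gegL_markov_upper lam_gt sp).
have [C [cC CB HC]] := markov_const_spec lam_gt B0 HB.
rewrite cC !lee_fin; split=> //.
(* [C], the square of the Markov constant, is admissible, so it bounds the ratio of the two traces;
   the denominator is positive since N >= 12. *)
have := @gegL_markov_lower _ _ lam_gt M C; rewrite -nM => /(_ HC).
rewrite sum_geg_inc // sum_geg_t //= -nM -/m -/a => TC.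
have N12 : 12 <= m * (m + a - 1).
  have -> : 12 = 4 * 3 :> R by ring.
  by rewrite ler_pM //; lra.
have tr0 : 0 < m * (m + a - 1) * (m * (m + a - 1) - 2) / (4 * a).
  by rewrite divr_gt0 ?mulr_gt0 //; lra.
rewrite -(ler_pM2r tr0); apply: le_trans TC; exact: geg_frobenius_lower.
Qed.
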